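(* For any $\epsilon>0$: 1. There exist a packing integer program as defined in $(\mathrm{P})$ and a partition $\mathcal{J}\subseteq2^{[n]}$ of the index set of columns of $A$ such that the graph $G^{\mathrm{pack}}_{A,\mathcal{J}}$ is a 3-cycle and $$z^{S.S.}\ge(3-\epsilon)z^I .$$ 2. (Strength of super sparse cuts for packing two-stage problems) There exist a packing integer program as defined in $(\mathrm{P})$ and a partition $\mathcal{J}\subseteq2^{[n]}$ of the index set of columns of $A$ such that the graph $G^{\mathrm{pack}}_{A,\mathcal{J}}$ is a star and $$z^{S.S.}\ge(2-\epsilon)z^I .$$
   Context: $[n]=\{1,\dots,n\}$. The packing problem $(\mathrm{P})$ is: maximize $c^Tx$ subject to $Ax\le b$, $x_j\in\mathbb{Z}_+$ for $j\in\mathcal{L}$, $x_j\in\mathbb{R}_+$ for $j\in[n]\setminus\mathcal{L}$, where $A\in\mathbb{Q}_+^{m\times n}$, $b\in\mathbb{Q}_+^m$, $c\in\mathbb{Q}_+^n$, $\mathcal{L}\subseteq[n]$. Let $P$ be its feasible region, $P^I$ the convex hull of $P$, and $P^{LP}$ the feasible region of its linear programming relaxation; $z^I=\max\{c^Tx:x\in P^I\}$. Sparse closures: for $N\subseteq[n]$, a sparse cut on $N$ is an inequality $\alpha^Tx\le\beta$ valid for $P^I$ with $\alpha_i=0$ for all $i\notin N$; $P^{(N)}$ is the set of points of $P^{LP}$ satisfying all sparse cuts on $N$. For a partition $\mathcal{J}=\{J_1,\dots,J_q\}$ of $[n]$, the packing interaction graph $G^{\mathrm{pack}}_{A,\mathcal{J}}$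 has one node $v_j$ for each block $J_j$, and distinct nodes $v_i,v_j$ are adjacent iff some row of $A$ has a nonzero entry in a column of $J_i$ and a nonzero entry in a column of $J_j$. A star is a graph consisting of a center adjacent to one or more leaves, with no other nodes or edges. Super sparse closure: $P^{S.S.}:=\bigcap_{j=1}^qP^{(J_j)}$ and $z^{S.S.}:=\max\{c^Tx:x\in P^{S.S.}\}$. *)

(* Defs.v *)
From mathcomp Require Import all_boot all_order all_algebra.
From mathcomp Require Import boolp classical_sets reals convex.

Set Implicit Arguments.
Unset Strict Implicit.
Unset Printing Implicit Defensive.

Import Order.TTheory GRing.Theory Num.Theory.

Local Open Scope ring_scope.

(* Maximize c^T x subject to A x <= b, x >= 0, with x_j integral for j in L. *)
Record packing_program (m n : nat) := PackingProgram {
  pp_A : 'M[rat]_(m, n);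
  pp_b : 'cV[rat]_m;
  pp_c : 'cV[rat]_n;
  pp_L : {set 'I_n};
  pp_A_ge0 : forall i j, 0 <= pp_A i j;
  pp_b_ge0 : forall i, 0 <= pp_b i 0;
  pp_c_ge0 : forall j, 0 <= pp_c j 0
}.

Definition dotv (R : realType) n (u v : 'cV[R]_n) : R :=
  \sum_(j < n) u j 0 * v j 0.

Definition LP_region (R : realType) m n (p : packing_program m n) :
    set 'cV[R]_n :=
  [set x : 'cV[R]_n |
     (forall i, (map_mx ratr (pp_A p) *m x) i 0 <= ratr (pp_b p i 0)) /\
     (forall j, 0 <= x j 0)]%classic.

Arguments LP_region R {m n} p.

Definition MIP_region (R : realType) m n (p : packing_program m n) :
    set 'cV[R]_n :=
  [set x : 'cV[R]_n | LP_region R p x /\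
     (forall j, j \in pp_L p -> x j 0 \is a Num.nat)]%classic.

Arguments MIP_region R {m n} p.

Definition conv_hull (R : realType) n (X : set 'cV[R]_n) : set 'cV[R]_n :=
  smallest (@convex_set R 'cV[R]_n) X.

Definition integer_hull (R : realType) m n (p : packing_program m n) :
    set 'cV[R]_n :=
  conv_hull (MIP_region R p).

Arguments integer_hull R {m n} p.

Definition sparse_cut (R : realType) m n (p : packing_program m n)
    (N : {set 'I_n}) (alpha : 'cV[R]_n) (beta : R) : Prop :=
  (forall x, integer_hull R p x -> dotv alpha x <= beta) /\
  (forall i, i \notin N -> alpha i 0 = 0).

Definition sparse_closure (R : realType) m n (p : packing_program m n)
    (N : {set 'I_n}) : set 'cV[R]_n :=
  [set x : 'cV[R]_n | LP_region R p x /\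
     (forall alpha beta, sparse_cut p N alpha beta ->
        dotv alpha x <= beta)]%classic.

Arguments sparse_closure R {m n} p N.

Definition super_sparse_closure (R : realType) m n (p : packing_program m n)
    (J : {set {set 'I_n}}) : set 'cV[R]_n :=
  (\bigcap_(N in [set` J]) sparse_closure R p N)%classic.

Arguments super_sparse_closure R {m n} p J.

(* The maximum is required to be attained, so unbounded or empty [X] have no
   maximum value. *)
Definition max_value (R : realType) m n (p : packing_program m n)
    (X : set 'cV[R]_n) (z : R) : Prop :=
  let values : set R := [set dotv (map_mx ratr (pp_c p)) x | x in X]%classic in
  values z /\ ubound values z.

(* The packing interaction graph has vertex set [J] (the blocks of the
   partition) and the following adjacency relation. *)
Definition pack_adj m n (A : 'M[rat]_(m, n)) : rel {set 'I_n} :=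
  fun U V => (U != V) &&
    [exists i, [exists j in U, A i j != 0] && [exists k in V, A i k != 0]].

(* In the next two definitions, a graph is a vertex set [V] with an adjacency
   relation [e], which is only considered on [V]. *)
Definition is_cycle_graph (T : finType) (k : nat) (V : {set T}) (e : rel T) :
    Prop :=
  exists c : seq T, [/\ size c = k, uniq c, V =i c &
    {in V &, forall u v, e u v = (v == next c u) || (u == next c v)}].

Definition is_star_graph (T : finType) (V : {set T}) (e : rel T) : Prop :=
  exists2 c, c \in V & (1 < #|V|)%N /\
    {in V &, forall u v, e u v = (u != v) && ((u == c) || (v == c))}.

(* Main.v *)
Require Import Defs.
From mathcomp Require Import all_boot all_order all_algebra.
From mathcomp Require Import boolp classical_sets reals convex.
From mathcomp Require Import interval_inference.

Import Order.TTheory GRing.Theory Num.Theory.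

Local Open Scope ring_scope.

(** Take the stable set problem on the complete graph with [2q] nodes, given by
    its edge constraints [x_u + x_v <= 1], and pair up the nodes into [q]
    blocks. The integer optimum is [1]. The point [(1/2, ..., 1/2)] satisfies the
    edge constraints, and on a block [{u, v}] it agrees with the midpoint of the
    feasible points [e_u] and [e_v], so it violates no sparse cut supported on
    one block; its value is [q]. Any two blocks are adjacent, so [q = 3] gives a
    3-cycle and [q = 2] a star with one leaf. *)

Definition edge_mx (n : nat) : 'M[rat]_(#|{: 'I_n * 'I_n}|, n) :=
  \matrix_(i, j) (j \in [set (enum_val i).1; (enum_val i).2])%:R.

Lemma edge_mx_ge0 (n : nat) i j : 0 <= edge_mx n i j.
Proof. by rewrite mxE ler0n. Qed.

Lemma const_mx1_ge0 (n : nat) (i : 'I_n) :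
  0 <= (const_mx 1 : 'cV[rat]_n) i 0.
Proof. by rewrite mxE. Qed.

(* The diagonal pairs [(u, u)] contribute the harmless rows [x_u <= 1]. *)
Definition clique_program (n : nat) : packing_program #|{: 'I_n * 'I_n}| n :=
  PackingProgram [set: 'I_n] (edge_mx_ge0 n)
    (const_mx1_ge0 _) (const_mx1_ge0 n).

Section CliqueProgram.
Variables (R : realType) (n : nat).
Implicit Types (x : 'cV[R]_n) (u v : 'I_n).

Lemma clique_LP_regionP x :
  LP_region R (clique_program n) x <->
  (forall u v, \sum_(w in [set u; v]) x w 0 <= 1) /\ (forall u, 0 <= x u 0).
Proof.
have row_sum i : (map_mx ratr (edge_mx n) *m x) i 0 =
    \sum_(w in [set (enum_val i).1; (enum_val i).2]) x w 0.
  rewrite mxE [RHS]big_mkcond; apply: eq_bigr => j _.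
  by rewrite !mxE ratr_nat; case: (j \in _); rewrite ?mul1r ?mul0r.
split=> -[le1 ge0]; split=> //; [move=> u v | move=> i].
  have := le1 (enum_rank (u, v)).
  by rewrite row_sum enum_rankK mxE rmorph1.
by rewrite row_sum mxE rmorph1.
Qed.

Lemma clique_objectiveE x :
  dotv (map_mx ratr (pp_c (clique_program n))) x = \sum_w x w 0.
Proof. by apply: eq_bigr => w _; rewrite !mxE rmorph1 mul1r. Qed.

Lemma dotv_delta (alpha : 'cV[R]_n) u : dotv alpha (delta_mx u 0) = alpha u 0.
Proof.
rewrite /dotv (bigD1 u) //= mxE !eqxx mulr1 big1 ?addr0 // => w neq_wu.
by rewrite mxE (negPf neq_wu) mulr0.
Qed.

Lemma sum_delta u : \sum_w (delta_mx u 0 : 'cV[R]_n) w 0 = 1.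
Proof.
by rewrite -clique_objectiveE dotv_delta !mxE rmorph1.
Qed.

Lemma delta_clique_hull u : integer_hull R (clique_program n) (delta_mx u 0).
Proof.
apply: sub_gen_smallest; split; last first.
  by move=> j _; rewrite mxE; apply: natr_nat.
have ge0 w : 0 <= (delta_mx u 0 : 'cV[R]_n) w 0 by rewrite mxE ler0n.
apply/clique_LP_regionP; split=> // v w.
(* The bound 1 is read as the sum of all entries of the unit vector; the entries outside
   [[set v; w]] are dropped by nonnegativity. *)
rewrite -(sum_delta u) [leRHS](bigID (mem [set v; w])) /= lerDl.
exact: sumr_ge0.
Qed.

(** By integrality a nonzero entry is at least 1, and the edges at its node then force every other
    entry to 0. *)
Lemma sum_clique_MIP_region x :
  MIP_region R (clique_program n) x -> \sum_w x w 0 <= 1.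
Proof.
move=> [/clique_LP_regionP [le1 ge0] int].
have [/existsP[u xu_neq0] | /existsPn x0] :=
    boolP [exists u, x u 0 != 0]; last first.
  by rewrite big1 // => w _; apply/eqP; rewrite -[_ == _]negbK x0.
have xu_ge1 : 1 <= x u 0.
  have /natrP[k xuE] := int u (finset.in_setT u).
  by move: xu_neq0; rewrite xuE pnatr_eq0 ler1n lt0n.
rewrite (bigD1 u) //= big1 => [|w neq_wu].
  (* The diagonal row at [u] bounds the one remaining entry. *)
  by have := le1 u u; rewrite finset.setUid big_set1 addr0.
apply/eqP; rewrite eq_le ge0 andbT -(lerD2l (x u 0)) addr0.
by have := le1 u w; rewrite big_setU1 ?big_set1 ?inE 1?eq_sym // => /le_trans->.
Qed.

(** The half-space [H] is convex and contains the integral points, hence also their hull. *)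
Lemma sum_clique_hull x :
  integer_hull R (clique_program n) x -> \sum_w x w 0 <= 1.
Proof.
pose H : set 'cV[R]_n := [set y : 'cV[R]_n | \sum_w y w 0 <= 1]%classic.
suff hullH : (integer_hull R (clique_program n) `<=` H)%classic by apply: hullH.
apply: smallest_sub => [y z t|]; last exact: sum_clique_MIP_region.
rewrite !inE /H /= => yH zH.
under eq_bigr do rewrite !mxE.
rewrite big_split /= -!mulr_sumr.
have t1 : 0 <= 1 - t%:num by rewrite subr_ge0.
apply: le_trans (lerD (ler_wpM2l _ yH) (ler_wpM2l t1 zH)) _ => //.
by rewrite !mulr1 addrC subrK.
Qed.

(** The node [u] rules out the empty graph, whose optimum is 0, and supplies the maximizer. *)
Lemma max_value_clique_hull u :
  max_value (clique_program n) (integer_hull R (clique_program n)) 1.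
Proof.
split=> [|_ [x hx <-]]; last by rewrite clique_objectiveE sum_clique_hull.
exists (delta_mx u 0); first exact: delta_clique_hull.
by rewrite clique_objectiveE sum_delta.
Qed.

Lemma half_sparse_closure u v : u != v ->
  sparse_closure R (clique_program n) [set u; v] (const_mx 2^-1).
Proof.
move=> neq_uv; split.
  apply/clique_LP_regionP; split=> [i j|i]; last by rewrite mxE invr_ge0 ler0n.
  under eq_bigr do rewrite mxE.
  (* At most two entries equal to 1/2 are summed, and only one if [i = j]. *)
  rewrite sumr_const -[_ *+ #|_|]mulr_natl ler_pdivrMr // mul1r ler_nat cards2.
  by case: eqP.
move=> alpha beta [valid supp].
have le_u := valid _ (delta_clique_hull u).
have le_v := valid _ (delta_clique_hull v).
rewrite !dotv_delta in le_u le_v.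
have -> : dotv alpha (const_mx 2^-1) = (alpha u 0 + alpha v 0) / 2.
  rewrite /dotv; under eq_bigr do rewrite mxE.
  rewrite -mulr_suml (bigID (mem [set u; v])) /=.
  rewrite [X in _ + X]big1 => [|i]; last exact: supp.
  by rewrite addr0 big_setU1 ?big_set1 ?inE.
by rewrite ler_pdivrMr // mulr_natr mulr2n lerD.
Qed.

End CliqueProgram.

(** The nodes form two copies of ['I_q], matched index by index; [split] then finds the block of a
    node, and [big_split_ord] turns a sum over nodes into a sum over blocks. *)
Definition pair_block (q : nat) (j : 'I_q) : {set 'I_(q + q)} :=
  [set lshift q j; rshift q j].

Definition pair_partition (q : nat) : {set {set 'I_(q + q)}} :=
  [set pair_block q j | j : 'I_q].

Section PairPartition.
Variable q : nat.
Implicit Types j k : 'I_q.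

(** This form yields both the injectivity of [pair_block] and the disjointness of the blocks. *)
Lemma pair_block_meet j k (i : 'I_(q + q)) :
  i \in pair_block q j -> i \in pair_block q k -> j = k.
Proof.
rewrite !inE => /orP[] /eqP-> /orP[] /eqP.
- by move/lshift_inj.
- by move/eqP; rewrite eq_lrshift.
- by move/eqP; rewrite eq_rlshift.
- by move/rshift_inj.
Qed.

Lemma lshift_in_pair_block j : lshift q j \in pair_block q j.
Proof. by rewrite !inE eqxx. Qed.

Lemma pair_block_inj : injective (pair_block q).
Proof.
move=> j k eq_jk; apply: (pair_block_meet _ _ (lshift q j)).
  exact: lshift_in_pair_block.
by rewrite -eq_jk lshift_in_pair_block.
Qed.

Lemma pair_partitionP : finset.partition (pair_partition q) [set: 'I_(q + q)].
Proof.
apply/and3P; split.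
- apply/eqP/finset.setP => i; rewrite inE; apply/bigcupP.
  exists (pair_block q (match split i with inl j => j | inr j => j end)).
    by apply/imsetP; eexists.
  by rewrite !inE; case: split_ordP => j ->; rewrite eqxx ?orbT.
- apply/finset.trivIsetP => _ _ /imsetP[j _ ->] /imsetP[k _ ->].
  apply: contraNT => /pred0Pn[i /andP[ij ik]].
  by rewrite (pair_block_meet _ _ _ ij ik).
- apply/imsetP => -[j _ /finset.setP/(_ (lshift q j))].
  by rewrite lshift_in_pair_block inE.
Qed.

Lemma clique_pack_adj :
  {in pair_partition q &, forall U V,
    pack_adj (pp_A (clique_program (q + q))) U V = (U != V)}.
Proof.
move=> _ _ /imsetP[j _ ->] /imsetP[k _ ->]; rewrite /pack_adj andb_idr // => _.
(* The row of the edge joining the left nodes of the two blocks meets both. *)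
apply/existsP; exists (enum_rank (lshift q j, lshift q k)).
apply/andP; split; apply/existsP.
  by exists (lshift q j); rewrite lshift_in_pair_block mxE enum_rankK !inE eqxx.
exists (lshift q k).
by rewrite lshift_in_pair_block mxE enum_rankK !inE eqxx orbT.
Qed.

Lemma max_value_clique_super_sparse (R : realType) (j0 : 'I_q) :
  max_value (clique_program (q + q))
    (super_sparse_closure R (clique_program (q + q)) (pair_partition q)) q%:R.
Proof.
split=> [|_ [x hx <-]].
  exists (const_mx 2^-1).
    move=> _ /imsetP[j _ ->]; apply: half_sparse_closure.
    by rewrite eq_lrshift.
  rewrite clique_objectiveE; under eq_bigr do rewrite mxE.
  rewrite sumr_const card_ord -[_ *+ (q + q)]mulr_natl natrD -mulr2n -[q%:R *+ 2]mulr_natr.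
  by rewrite mulfK // pnatr_eq0.
(* An intersection over no blocks would be the whole space, so the block of [j0] is what places [x]
   in the LP region. Adding the edge constraints inside the [q] blocks then bounds the objective by
   [q]. *)
have [/clique_LP_regionP [le1 _] _] := hx (pair_block q j0) (imset_f _ isT).
rewrite clique_objectiveE big_split_ord /= -big_split /=.
rewrite -[X in _ <= X%:R]card_ord -sumr_const ler_sum // => j _.
have := le1 (lshift q j) (rshift q j).
by rewrite big_setU1 ?big_set1 // inE eq_lrshift.
Qed.

End PairPartition.

(** On three vertices the cycle is the complete graph, so any ordering of the blocks serves. *)
Lemma clique_cycle :
  is_cycle_graph 3 (pair_partition 3) (pack_adj (pp_A (clique_program 6))).
Proof.
pose c := [seq pair_block 3 j | j <- enum 'I_3].
have Jc : pair_partition 3 =i c.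
  move=> U; apply/imsetP/mapP => -[j _ ->]; exists j => //.
  by rewrite mem_enum.
have uniq_c : uniq c.
  by rewrite map_inj_uniq ?enum_uniq //; apply: pair_block_inj.
exists c; split=> //; first by rewrite size_map size_enum_ord.
move=> U V JU JV; rewrite (clique_pack_adj _ _ _ JU JV).
move: JU JV; rewrite !Jc; move: uniq_c; rewrite /c !enum_ordSl enum_ord0 /=.
(* Only distinctness of the three blocks matters from here; [next] is evaluated in the nine cases
   for [U] and [V]. *)
move: (pair_block 3 _) (pair_block 3 _) (pair_block 3 _) => Z Y X.
rewrite !inE !andbT negb_or => /andP[/andP[XY XZ] YZ].
have [YX ZX ZY] : [/\ Y != X, Z != X & Z != Y] by split; rewrite eq_sym.
by move=> UE VE; case/or3P: UE => /eqP->; case/or3P: VE => /eqP->;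
   rewrite !(eqxx, negPf XY, negPf XZ, negPf YZ, negPf YX, negPf ZX, negPf ZY).
Qed.

(** With two blocks, either one can be the center, since two distinct blocks always include it. *)
Lemma clique_star :
  is_star_graph (pair_partition 2) (pack_adj (pp_A (clique_program 4))).
Proof.
exists (pair_block 2 0); first exact: imset_f.
split; first by rewrite card_imset ?card_ord //; apply: pair_block_inj.
move=> U V JU JV; rewrite (clique_pack_adj _ _ _ JU JV).
case/imsetP: JU JV => j _ -> /imsetP[k _ ->].
rewrite !(inj_eq (pair_block_inj 2)).
by case: j k => [[|[|//]] ?] [[|[|//]] ?].
Qed.

Theorem theorem13 (R : realType) (eps : R) (eps_gt0 : 0 < eps) :
  (exists (m n : nat) (p : packing_program m n) (J : {set {set 'I_n}})
          (zI zSS : R),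
     [/\ finset.partition J [set: 'I_n],
         is_cycle_graph 3 J (pack_adj (pp_A p)),
         max_value p (integer_hull R p) zI,
         max_value p (super_sparse_closure R p J) zSS &
         0 < zI /\ (3 - eps) * zI <= zSS]) /\
  (exists (m n : nat) (p : packing_program m n) (J : {set {set 'I_n}})
          (zI zSS : R),
     [/\ finset.partition J [set: 'I_n],
         is_star_graph J (pack_adj (pp_A p)),
         max_value p (integer_hull R p) zI,
         max_value p (super_sparse_closure R p J) zSS &
         0 < zI /\ (2 - eps) * zI <= zSS]).
Proof.
(* The factor 1 is the integer optimum, and the right-hand side is the optimum over the super sparse
   closure. *)
have ratio (q : nat) : (q%:R - eps) * 1 <= q%:R.
  by rewrite mulr1 gerBl ltW.
split.
  exists _, _, (clique_program (3 + 3)), (pair_partition 3), 1, 3; split.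
  - exact: pair_partitionP.
  - exact: clique_cycle.
  - exact: (max_value_clique_hull R (3 + 3) 0).
  - exact: (max_value_clique_super_sparse 3 R 0).
  - by split; [exact: ltr01 | exact: ratio].
exists _, _, (clique_program (2 + 2)), (pair_partition 2), 1, 2; split.
- exact: pair_partitionP.
- exact: clique_star.
- exact: (max_value_clique_hull R (2 + 2) 0).
- exact: (max_value_clique_super_sparse 2 R 0).
- by split; [exact: ltr01 | exact: ratio].
Qed.
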